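(* Let $H=(V,E)$ be a $3$-uniform hypergraph with $m$ edges. Then $\tau_c(H)\le m/2$. Furthermore, equality $\tau_c(H)=m/2$ holds if and only if every component of $H$ is a $2$-cycle.
   Context: A hypergraph $H=(V,E)$ consists of a finite vertex set $V$ and a set $E$ of edges, each edge being a subset of $V$. $H$ is $3$-uniform if $|e|=3$ for each $e\in E$. For an integer $k\ge 2$, a cycle of length $k$ in $H$ is a sequence $v_1e_1v_2e_2\cdots v_ke_kv_1$ such that $e_1,\dots,e_k$ are distinct edges of $H$, $v_1,\dots,v_k$ are distinct vertices of $H$, and $\{v_i,v_{i+1}\}\subseteq e_i$ for each $i\in\{1,\dots,k\}$, where $v_{k+1}=v_1$. For $S\subseteq V$, $H\setminus S$ is the hypergraph obtained from $H$ by deleting the vertices of $S$ together with all edges that contain at least one vertex of $S$. A set $S\subseteq V$ is a feedback vertex set (FVS) of $H$ if $H\setminus S$ has no cycle. $\tau_c(H)$ denotes the minimum cardinality of a FVS of $H$. The components of $H$ are its maximal connected subhypergraphs, where two vertices are connected if they are equal or are joined by a sequence of edges in which consecutive edges intersect, the first containing one vertex and the last containing the other. A component is a $2$-cycle if it consists of exactly two distinct edges $e_1,e_2$ (and their vertices) forming a cycle of length $2$, i.e. the two edges share two distinct vertices $v_1,v_2$.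
   Formalization: In the equality characterization, ''every component'' is read as every component containing at least one edge, because an isolated vertex is a component that is not a 2-cycle (V={x}, E=∅ has τ_c=0=m/2); the bound is unchanged. *)

(* Defs.v *)
From mathcomp Require Import all_boot.
From mathcomp Require Import boolp.

Set Implicit Arguments.
Unset Strict Implicit.
Unset Printing Implicit Defensive.

(* The vertex set is a subset of an ambient finite type, so that deleting
   vertices and taking subhypergraphs stay within the same type. *)
Record hypergraph (T : finType) := Hypergraph {
  vset : {set T};
  eset : {set {set T}};
  eset_sub : forall e : {set T}, e \in eset -> e \subset vset
}.

Section Hypergraph.
Variable T : finType.
Implicit Types (H C D : hypergraph T) (S : {set T}).

Definition uniform (r : nat) H : Prop := forall e : {set T}, e \in eset H -> #|e| = r.

(* [ordS] is the cyclic successor on 'I_k, hence v_{k+1} = v_1. *)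
Definition is_cycle H (k : nat) (v : 'I_k -> T) (e : 'I_k -> {set T}) : Prop :=
  [/\ 2 <= k, injective v, injective e,
      forall i, v i \in vset H /\ e i \in eset H
    & forall i, [set v i; v (ordS i)] \subset e i].

Definition acyclic H : Prop :=
  forall (k : nat) (v : 'I_k -> T) (e : 'I_k -> {set T}), ~ is_cycle H v e.

Lemma del_vertices_sub H S :
  forall e : {set T}, e \in [set f in eset H | [disjoint f & S]] ->
    e \subset vset H :\: S.
Proof.
move=> e; rewrite inE => /andP[eH eS].
by rewrite subsetD eS (eset_sub eH).
Qed.

Definition del_vertices H S : hypergraph T := Hypergraph (@del_vertices_sub H S).

Definition fvs H S : Prop := S \subset vset H /\ acyclic (del_vertices H S).

Lemma fvs_vset H : fvs H (vset H).
Proof.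
split=> // k v e [k2 _ _ inH _].
have [] := inH (Ordinal (ltnW k2)).
by rewrite /= setDv inE.
Qed.

Definition tau_c H : nat := #|[arg min_(S < vset H | `[< fvs H S >]) #|S|]|.

Lemma tau_c_attained H : exists2 S, fvs H S & #|S| = tau_c H.
Proof.
rewrite /tau_c; case: arg_minnP => [|S /asboolP fS _].
  exact/asboolP/fvs_vset.
by exists S.
Qed.

Lemma tau_c_min H S : fvs H S -> tau_c H <= #|S|.
Proof.
move=> fS; rewrite /tau_c; case: arg_minnP => [|S' _ min].
  exact/asboolP/fvs_vset.
exact/min/asboolP.
Qed.

Definition vconnected H (x y : T) : Prop :=
  x = y \/ exists (e : {set T}) (p : seq {set T}),
    [/\ all [in eset H] (e :: p),
        path (fun f g : {set T} => f :&: g != set0) e p,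
        x \in e & y \in last e p].

(* As usual, the hypergraph without vertices is not counted as connected. *)
Definition connected H : Prop :=
  vset H != set0 /\ {in vset H &, forall x y, vconnected H x y}.

Definition subhypergraph C H : Prop :=
  vset C \subset vset H /\ eset C \subset eset H.

Definition component H C : Prop :=
  [/\ subhypergraph C H, connected C
    & forall D, subhypergraph D H -> connected D ->
        subhypergraph C D -> subhypergraph D C].

Definition two_cycle C : Prop :=
  exists (v : 'I_2 -> T) (e : 'I_2 -> {set T}),
    [/\ is_cycle C v e, eset C = [set e i | i : 'I_2]
      & vset C = \bigcup_i e i].

(* An isolated vertex forms a component without edges, which is never a 2-cycle
   although it affects neither tau_c nor the number of edges: a single vertex
   with no edge has tau_c = 0 = m/2. Hence the characterization of equality is
   about the components that have an edge; these are all the components when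
   there are no isolated vertices. *)
Definition nontrivial C : Prop := eset C != set0.

End Hypergraph.

(* Main.v *)
(* Deleting a vertex of degree at least 2 kills at least two edges, and once
   all degrees are at most 1 there is no cycle left; hence the bound m/2.

   If no feedback set beats m/2, all degrees are at most 2, every edge has two
   vertices of degree 2, and deleting a vertex of degree 2 preserves this
   tightness.  Let e, f share two vertices a, b, and let another edge meet e
   in x.  After deleting x, the vertices a and b of f have degree 1, so f is on
   no cycle and the bound is strict: a contradiction.  So a pair of edges
   sharing two vertices is a component.  If e meets distinct edges f and g in
   its degree-2 vertices a and b, then by induction g has such a partner h in the
   family with a deleted, so {g, h} is isolated in the whole family although e
   meets g: a contradiction.  Hence every edge belongs to an isolated pair.

   Conversely, if the edges form isolated pairs, a feedback set meets each
   pair, and each vertex meets at most one. *)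
Require Import Defs.
From mathcomp Require Import all_boot all_order all_algebra.
From mathcomp Require Import boolp zify.

Set Implicit Arguments.
Unset Strict Implicit.
Unset Printing Implicit Defensive.

(** * Cycles and feedback sets of edge families *)

Section EdgeFamilies.
Variable T : finType.
Implicit Types (E : {set {set T}}) (e f g : {set T}) (S : {set T}) (a b v x : T).

(** No vertex set is carried, so that inductions can shrink the edge family freely; the vertices of
    a cycle lie on its edges anyway. *)
Definition cycle_free E : Prop :=
  forall (k : nat) (v : 'I_k -> T) (e : 'I_k -> {set T}),
    1 < k -> injective v -> injective e -> (forall i, e i \in E) ->
    (forall i, [set v i; v (ordS i)] \subset e i) -> False.

Definition avoid E S := [set f in E | [disjoint f & S]].

Definition feedback E S : Prop := cycle_free (avoid E S).

Definition uniform3 E : Prop := forall e, e \in E -> #|e| = 3.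

Definition del E v := [set f in E | v \notin f].

Definition deg E v := #|[set f in E | v \in f]|.

(** For [e] in [E] these are the vertices of [e] of degree at least 2. *)
Definition shared E e := [set x in e | [exists f in E, (f != e) && (x \in f)]].

Definition below_half E : Prop := exists2 S, feedback E S & 2 * #|S| < #|E|.

Definition isolated_pair E e f : Prop :=
  forall g, g \in E -> g :&: (e :|: f) != set0 -> g = e \/ g = f.

(** For 3-uniform families, this is the edge-only form of the condition that every component with an
    edge is a 2-cycle. *)
Definition paired E : Prop :=
  forall e, e \in E -> exists f,
    [/\ f \in E, f != e, 1 < #|e :&: f| & isolated_pair E e f].

Lemma cycle_freeS E E' : E' \subset E -> cycle_free E -> cycle_free E'.
Proof.
move=> sub cf k v e k1 iv ie eE ve; apply: (cf k v e) => // i.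
exact: (subsetP sub).
Qed.

Lemma ordS_neq k (i : 'I_k) : 1 < k -> ordS i != i.
Proof.
move=> k1; apply/eqP => /(congr1 val) /= h.
have ik := ltn_ord i; have [h1|h1] := ltnP i.+1 k.
  by rewrite modn_small in h; lia.
have ek : i.+1 = k by lia.
by rewrite ek modnn in h; lia.
Qed.

(** The edge [e i] shares [v i] with its predecessor and [v (ordS i)] with its successor on the
    cycle; both differ from [e i] because [1 < k]. *)
Lemma shared_cycle E k (v : 'I_k -> T) (e : 'I_k -> {set T}) :
  1 < k -> injective v -> injective e -> (forall i, e i \in E) ->
  (forall i, [set v i; v (ordS i)] \subset e i) ->
  forall i, 1 < #|shared E (e i)|.
Proof.
move=> k1 iv ie eE ve i.
have ve1 j : v j \in e j by apply: (subsetP (ve j)); rewrite !inE eqxx.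
have ve2 j : v (ordS j) \in e j.
  by apply: (subsetP (ve j)); rewrite !inE eqxx orbT.
apply/card_gt1P; exists (v i), (v (ordS i)); split.
- rewrite inE ve1; apply/exists_inP; exists (e (ord_pred i)) => //.
  have := ve2 (ord_pred i); rewrite ord_predK => ->; rewrite andbT.
  rewrite (inj_eq ie) eq_sym -{1}[i]ord_predK; exact: ordS_neq.
- rewrite inE ve2; apply/exists_inP; exists (e (ordS i)) => //.
  by rewrite ve1 andbT (inj_eq ie) ordS_neq.
- by rewrite (inj_eq iv) eq_sym ordS_neq.
Qed.

Definition two (A : Type) (x y : A) (i : 'I_2) : A := if i == ord0 then x else y.

Lemma two_inj (A : eqType) (x y : A) : x != y -> injective (two x y).
Proof.
move=> xy [[|[|//]] Hi] [[|[|//]] Hj] h; try exact: val_inj.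
  by move: xy; rewrite /two /= in h; rewrite h eqxx.
by move: xy; rewrite /two /= in h; rewrite h eqxx.
Qed.

Lemma two_sub a b e f : a \in e :&: f -> b \in e :&: f ->
  forall i, [set two a b i; two a b (ordS i)] \subset two e f i.
Proof.
rewrite !inE => /andP[ae af] /andP[be bf] [[|[|//]] Hi];
  by rewrite subUset !sub1set /two /= ?ae ?af ?be ?bf.
Qed.

Lemma cycle2 E e f : e \in E -> f \in E -> f != e -> 1 < #|e :&: f| ->
  ~ cycle_free E.
Proof.
move=> eE fE fe /card_gt1P[a [b [aef bef ab]]].
move/(_ 2 (two a b) (two e f)); apply=> //.
- exact: two_inj.
- by apply: two_inj; rewrite eq_sym.
- by move=> i; rewrite /two; case: ifP.
- exact: two_sub.
Qed.

Lemma delS E v : del E v \subset E.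
Proof. by apply/subsetP=> f; rewrite inE => /andP[]. Qed.

Lemma uniform3S E E' : E' \subset E -> uniform3 E -> uniform3 E'.
Proof. by move=> sub u e /(subsetP sub) /u. Qed.

Lemma card_del E v : #|del E v| + deg E v = #|E|.
Proof.
rewrite addnC -(cardsID [set f : {set T} | v \in f] E) /deg; congr (_ + _).
  by apply: eq_card => f; rewrite !inE.
by apply: eq_card => f; rewrite !inE andbC.
Qed.

Lemma feedback_del E v S : feedback (del E v) S -> feedback E (v |: S).
Proof.
apply: cycle_freeS; apply/subsetP=> f; rewrite !inE => /andP[-> d] /=.
apply/andP; split.
  by apply: contraL d => vf; apply/pred0Pn; exists v; rewrite /= vf !inE eqxx.
by apply: disjointWr d; apply: subsetUr.
Qed.

Lemma cardsU1_le v S : #|v |: S| <= #|S|.+1.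
Proof. by rewrite cardsU1; case: (v \notin S). Qed.

(** * The upper bound *)

Lemma feedback_le_half E : exists2 S, feedback E S & 2 * #|S| <= #|E|.
Proof.
have [n] := ubnP #|E|; elim: n E => // n IH E En.
case: (pselect (exists v, 1 < deg E v)) => [[v dv]|no].
  have cE := card_del E v.
  have [|S fS cS] := IH (del E v); first by lia.
  exists (v |: S); first exact: feedback_del.
  by have := cardsU1_le v S; lia.
(* All degrees are at most 1 here, so no edge has a shared vertex, whereas an edge on a cycle has
   two. *)
exists set0; last by rewrite cards0.
move=> k v e k1 iv ie eE ve.
have i0 : 'I_k := Ordinal (ltnW k1).
have := shared_cycle k1 iv ie eE ve i0.
move=> /ltnW/card_gt0P[x]; rewrite inE => /andP[xe /exists_inP[f fE /andP[fe xf]]].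
apply: no; exists x; apply/card_gt1P; exists (e i0), f.
by move: (eE i0) fE; rewrite !inE eq_sym => /andP[-> _] /andP[-> _].
Qed.

(** * Families for which the bound is tight *)

(** One vertex is spent on at least two edges, so a strict gain is kept; contrapositively, tightness
    passes to [del E v]. *)
Lemma below_half_del E v : 1 < deg E v -> below_half (del E v) -> below_half E.
Proof.
move=> dv [S fS cS]; exists (v |: S); first exact: feedback_del.
by have := card_del E v; have := cardsU1_le v S; lia.
Qed.

(** One vertex removes at least three edges, so the general bound on the remaining family already
    gives strictness. *)
Lemma below_half_deg3 E v : 2 < deg E v -> below_half E.
Proof.
move=> dv; have [S fS cS] := feedback_le_half (del E v).
exists (v |: S); first exact: feedback_del.
by have := card_del E v; have := cardsU1_le v S; lia.
Qed.

(* An edge with at most one shared vertex lies on no cycle, so it can be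
   removed for free. *)
Lemma below_half_pendant E e : e \in E -> #|shared E e| <= 1 -> below_half E.
Proof.
move=> eE se; have [S fS cS] := feedback_le_half (E :\ e).
exists S; last by rewrite (cardsD1 e E) eE add1n ltnS.
move=> k v c k1 iv ic cE vc.
case: (pselect (exists i, c i = e)) => [[i ci]|no].
  have := shared_cycle k1 iv ic cE vc i; rewrite ltnNge => /negP; apply.
  apply: leq_trans se; rewrite ci; apply/subset_leq_card/subsetP => x.
  rewrite !inE => /andP[-> /exists_inP[f]]; rewrite inE => /andP[fE _] h.
  by apply/exists_inP; exists f.
apply: (fS k v c) => // i; move: (cE i); rewrite !inE => /andP[-> ->].
by rewrite !andbT; apply/eqP => ci; apply: no; exists i.
Qed.

Lemma not_below_half_deg E e f g v : ~ below_half E -> e \in E -> f \in E -> g \in E ->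
  v \in e -> v \in f -> v \in g -> f != e -> g = e \/ g = f.
Proof.
move=> ng eE fE gE ve vf vg fe.
have [->|ge] := eqVneq g e; first by left.
have [->|gf] := eqVneq g f; first by right.
case: ng; apply: (@below_half_deg3 E v).
have <- : #|[set e; f; g]| = 3.
  by rewrite setUC cardsU1 cards2 !inE negb_or ge gf eq_sym fe.
apply/subset_leq_card/subsetP => h; rewrite !inE.
by move=> /orP[/orP[]|] /eqP->; apply/andP.
Qed.

Lemma deg_gt1 E e f v : e \in E -> f \in E -> v \in e -> v \in f -> f != e ->
  1 < deg E v.
Proof.
move=> eE fE ve vf fe; apply/card_gt1P; exists e, f.
by rewrite !inE eE fE ve vf eq_sym fe.
Qed.

Lemma double_edge_side E e f g x : uniform3 E -> ~ below_half E ->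
  e \in E -> f \in E -> f != e -> 1 < #|e :&: f| ->
  g \in E -> x \in g -> x \in e -> g = e \/ g = f.
Proof.
move=> u ng eE fE fe /card_gt1P[a [b [aef bef ab]]] gE xg xe.
have [->|ge] := eqVneq g e; first by left.
have [->|gf] := eqVneq g f; first by right.
case: (ng); apply: (@below_half_del E x); first exact: (deg_gt1 eE gE xe xg ge).
have xf : x \notin f.
  apply/negP => xf; case: (not_below_half_deg ng eE fE gE xe xf xg fe) => h.
    by rewrite h eqxx in ge.
  by rewrite h eqxx in gf.
apply: (@below_half_pendant _ f); first by rewrite inE fE.
move: aef bef; rewrite !inE => /andP[ae af] /andP[be bf].
(* The only edges of [E] at [y] are [e] and [f], and [e] disappears with [x]. *)
have private y : y \in e -> y \in f -> y \notin shared (del E x) f.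
  move=> ye yf; rewrite inE yf; apply/negP => /exists_inP[h].
  rewrite inE => /andP[hE xh] /andP[hf yh].
  case: (not_below_half_deg ng eE fE hE ye yf yh fe) => hh.
    by rewrite hh xe in xh.
  by rewrite hh eqxx in hf.
(* Of the three vertices of [f], only the one other than [a] and [b] can still be shared. *)
have sub : shared (del E x) f \subset f :\ a :\ b.
  apply/subsetP => y ys; rewrite !inE; apply/and3P; split.
  - by apply: contraL ys => /eqP->; apply: private.
  - by apply: contraL ys => /eqP->; apply: private.
  - by move: ys; rewrite inE => /andP[].
apply: leq_trans (subset_leq_card sub) _.
move: (cardsD1 a f); rewrite af (u _ fE) (cardsD1 b (f :\ a)).
by rewrite in_setD1 bf eq_sym ab !add1n => -[<-].
Qed.

Lemma double_edge_isolated E e f : uniform3 E -> ~ below_half E ->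
  e \in E -> f \in E -> f != e -> 1 < #|e :&: f| -> isolated_pair E e f.
Proof.
move=> u ng eE fE fe cef g gE /set0Pn[x]; rewrite !inE => /andP[xg /orP[xe|xf]].
  exact: (double_edge_side u ng eE fE fe cef gE xg xe).
rewrite setIC in cef; rewrite eq_sym in fe.
by case: (double_edge_side u ng fE eE fe cef gE xg xf); [right | left].
Qed.

Lemma not_below_half_paired E : uniform3 E -> ~ below_half E -> paired E.
Proof.
have [n] := ubnP #|E|; elim: n E => // n IH E En u ng e eE.
have : 1 < #|shared E e|.
  by rewrite ltnNge; apply/negP => se; apply: ng; apply: below_half_pendant se.
move=> /card_gt1P[a [b [sa sb ab]]].
move: sa sb; rewrite !inE.
move=> /andP[ae /exists_inP[f fE /andP[fe af]]].
move=> /andP[be /exists_inP[g gE /andP[ge bg]]].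
(* If a single edge meets [e] in both [a] and [b], it is the partner of [e]; otherwise deleting [a]
   leads to a contradiction. *)
have [fg|fg] := eqVneq f g.
  have cef : 1 < #|e :&: f|.
    by apply/card_gt1P; exists a, b; rewrite !inE ae af be fg bg.
  by exists f; split => //; apply: double_edge_isolated.
have da := deg_gt1 eE fE ae af fe.
have ag : a \notin g.
  apply/negP => ag; case: (not_below_half_deg ng eE fE gE ae af ag fe) => h.
    by rewrite h eqxx in ge.
  by rewrite h eqxx in fg.
have ngd : ~ below_half (del E a) by move=> /(below_half_del da).
have dn : #|del E a| < n.
  apply: leq_trans (_ : #|E| <= n) => //.
  by rewrite -(card_del E a) -[X in X < _]addn0 ltn_add2l ltnW.
have gd : g \in del E a by rewrite inE gE.
(* The partner [h] of [g] avoids [a]. The pair [g], [h] is isolated in all of [E], yet [e] meets it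
   in [b] and, containing [a], is neither of the two. *)
have [h [hd hg cgh _]] := IH _ dn (uniform3S (@delS E a) u) ngd g gd.
move: hd; rewrite inE => /andP[hE ah].
have bgh : e :&: (g :|: h) != set0.
  by apply/set0Pn; exists b; rewrite !inE be bg.
have [eg|eh] := double_edge_isolated u ng gE hE hg cgh eE bgh.
  by rewrite eg eqxx in ge.
by rewrite -eh ae in ah.
Qed.

(** * The lower bound for paired families *)

Lemma paired_feedback E S : paired E -> feedback E S -> #|E| <= 2 * #|S|.
Proof.
move=> P fS.
(* For [s] on some edge, [N s] is the isolated pair around [s]; otherwise it is empty. The sets
   [N s] with [s] in [S] cover [E], and each has at most two elements. *)
pose N s := [set e in E | [exists f in E, (s \in f) && (e :&: f != set0)]].
have EN : E \subset \bigcup_(s in S) N s.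
  apply/subsetP => e eE; have [f [fE fe cef _]] := P e eE.
  have [[s sS sef]|no] := pselect (exists2 s, s \in S & s \in e :|: f).
    apply/bigcupP; exists s => //; rewrite inE eE; apply/exists_inP.
    move: sef; rewrite inE => /orP[se|sf].
      by exists e; rewrite // se; apply/set0Pn; exists s; rewrite inE se.
    by exists f; rewrite // sf -card_gt0 ltnW.
  (* If [S] misses [e :|: f], both edges survive and form a cycle of length 2. *)
  have dis (h : {set T}) : h \subset e :|: f -> [disjoint h & S].
    move=> sub; apply/pred0P => s /=; apply/negP => /andP[sh sS].
    by apply: no; exists s; last exact: (subsetP sub).
  have eA : e \in avoid E S by rewrite inE eE dis ?subsetUl.
  have fA : f \in avoid E S by rewrite inE fE dis ?subsetUr.
  by case: (cycle2 eA fA fe cef).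
apply: leq_trans (subset_leq_card EN) _.
rewrite mulnC -sum_nat_const; elim/big_rec2: _ => [|s m A _ IH].
  by rewrite cards0.
apply: leq_trans (leq_card_setU _ _) (leq_add _ IH).
have [->|[e0]] := set_0Vmem (N s); first by rewrite cards0.
rewrite inE => /andP[_ /exists_inP[f0 f0E /andP[sf0 _]]].
have [f1 [f1E _ _ iso]] := P _ f0E.
have : N s \subset [set f0; f1].
  apply/subsetP => e; rewrite inE => /andP[eE /exists_inP[f fE /andP[sf ef]]].
  have ff : f \subset f0 :|: f1.
    have ff : f :&: (f0 :|: f1) != set0.
      by apply/set0Pn; exists s; rewrite !inE sf sf0.
    by have [->|->] := iso f fE ff; rewrite ?subsetUl ?subsetUr.
  have e01 : e :&: (f0 :|: f1) != set0.
    have /set0Pn[x] := ef; rewrite inE => /andP[xe xf].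
    by apply/set0Pn; exists x; rewrite inE xe (subsetP ff).
  by have [->|->] := iso e eE e01; rewrite !inE eqxx ?orbT.
move=> /subset_leq_card h; apply: leq_trans h _.
by rewrite cards2; case: (_ != _).
Qed.

End EdgeFamilies.

(** * From edge families to hypergraphs *)

Section Hypergraphs.
Variable T : finType.
Implicit Types (H C D : hypergraph T) (S e f g : {set T}).

Lemma cycle_free_acyclic H : cycle_free (eset H) -> acyclic H.
Proof.
move=> cf k v e [k1 iv ie vH ve]; apply: (cf k v e) => // i.
by have [] := vH i.
Qed.

Lemma acyclic_cycle_free H : acyclic H -> cycle_free (eset H).
Proof.
move=> ac k v e k1 iv ie eH ve; apply: (ac k v e); split=> // i; split=> //.
by apply: (subsetP (eset_sub (eH i))); apply: (subsetP (ve i)); rewrite !inE eqxx.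
Qed.

Lemma tau_c_le_feedback H S : feedback (eset H) S -> tau_c H <= #|S|.
Proof.
move=> fS; apply: leq_trans (subset_leq_card (subsetIr (vset H) S)).
apply: tau_c_min; split; first exact: subsetIl.
apply: cycle_free_acyclic; apply: cycle_freeS fS.
apply/subsetP=> f; rewrite !inE => /andP[fH d]; rewrite fH /=.
apply/pred0P=> x /=; apply/negP=> /andP[xf xS].
move/pred0P: d => /(_ x) /=; rewrite inE xf xS.
by rewrite (subsetP (eset_sub fH)).
Qed.

Lemma double_tau_c_le H : 2 * tau_c H <= #|eset H|.
Proof.
have [S fS cS] := feedback_le_half (eset H).
by have := tau_c_le_feedback fS; lia.
Qed.

Lemma double_tau_c_eq H : uniform 3 H ->
  (2 * tau_c H = #|eset H|) <-> paired (eset H).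
Proof.
move=> u; split=> [eq|P].
  apply: not_below_half_paired u _ => -[S /tau_c_le_feedback fS cS].
  by lia.
apply/eqP; rewrite eqn_leq double_tau_c_le /=.
have [S [_ /acyclic_cycle_free fS] <-] := tau_c_attained H.
exact: paired_feedback P fS.
Qed.

Lemma uniform_meet_self H e : uniform 3 H -> e \in eset H -> e :&: e != set0.
Proof. by move=> u eH; rewrite setIid -card_gt0 u. Qed.

(** * The component of an edge *)

(** Both memberships are built in, so that chains starting at an edge of [H] stay in [eset H]. *)
Definition meet_rel H (f g : {set T}) : bool :=
  [&& f \in eset H, g \in eset H & f :&: g != set0].

Lemma meet_rel_sym H : connect_sym (meet_rel H).
Proof.
apply: sym_connect_sym => f g; rewrite /meet_rel /= setIC.
by case: (f \in _); case: (g \in _).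
Qed.

Lemma connect_eset H e f : e \in eset H -> connect (meet_rel H) e f -> f \in eset H.
Proof.
move=> eH /connectP[p pp ->]; elim: p e eH pp => //= g p IH e _.
by move=> /andP[/and3P[_ gH _]]; apply: IH.
Qed.

Lemma path_connect H e p : all [in eset H] (e :: p) ->
  path (fun f g : {set T} => f :&: g != set0) e p ->
  connect (meet_rel H) e (last e p).
Proof.
elim: p e => //= g p IH e /and3P[eH gH pH] /andP[eg pp].
apply: connect_trans (IH g _ pp); last by rewrite /= gH.
by apply: connect1; rewrite /meet_rel eH gH.
Qed.

Lemma component_edges_sub H e :
  forall f, f \in [set g | connect (meet_rel H) e g] ->
    f \subset cover [set g | connect (meet_rel H) e g].
Proof. by move=> f fC; apply: bigcup_sup. Qed.

Definition edge_component H e : hypergraph T :=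
  Hypergraph (@component_edges_sub H e).

Lemma edge_component_connected H e : uniform 3 H -> e \in eset H ->
  connected (edge_component H e).
Proof.
move=> u eH; split.
  have /set0Pn[x] := uniform_meet_self u eH; rewrite setIid => xe.
  by apply/set0Pn; exists x; apply/bigcupP; exists e; rewrite // inE.
move=> y z /bigcupP[f]; rewrite inE => ef yf /bigcupP[g]; rewrite inE => eg zg.
right; exists f.
have : connect (meet_rel H) f g.
  by apply: connect_trans eg; rewrite meet_rel_sym.
move=> /connectP[p pp lp]; exists p; split=> //; last by rewrite -lp.
- rewrite /= inE ef /= {lp g eg zg yf}.
  elim: p f ef pp => //= g p IH f ef /andP[fg pp].
  have eg : connect (meet_rel H) e g by apply: connect_trans ef (connect1 fg).
  by rewrite inE eg /=; apply: IH pp.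
- by apply: sub_path pp => a b /= /and3P[].
Qed.

(** For maximality, a chain in [D] from a vertex of [e] to [y] ends in an edge linked to [e], so [y]
    is covered; an edge of [D] then meets a linked edge and is linked itself. *)
Lemma edge_component_component H e : uniform 3 H -> e \in eset H ->
  component H (edge_component H e).
Proof.
move=> u eH; have sub : subhypergraph (edge_component H e) H.
  split; last by apply/subsetP=> f; rewrite inE => /(connect_eset eH).
  apply/bigcupsP=> f; rewrite inE => /(connect_eset eH); exact: eset_sub.
split=> //; first exact: edge_component_connected.
move=> D [_ DH] [_ cD] [CD _].
have /set0Pn[x] := uniform_meet_self u eH; rewrite setIid => xe.
have xC : x \in vset (edge_component H e).
  by apply/bigcupP; exists e; rewrite // inE.
have vDC : vset D \subset vset (edge_component H e).
  apply/subsetP=> y yD.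
  have [<- //|[f [p [fp pp xf yl]]]] := cD x y (subsetP CD _ xC) yD.
  have fpH : all [in eset H] (f :: p).
    by apply: sub_all fp => g; apply: (subsetP DH).
  apply/bigcupP; exists (last f p) => //; rewrite inE.
  apply: connect_trans (path_connect fpH pp); apply: connect1.
  move: fpH => /= /andP[fH _]; rewrite /meet_rel eH fH /=.
  by apply/set0Pn; exists x; rewrite inE xe.
split=> //; apply/subsetP=> g gD; have gH := subsetP DH g gD.
have /set0Pn[y] := uniform_meet_self u gH; rewrite setIid => yg.
have /bigcupP[h] := subsetP vDC y (subsetP (eset_sub gD) y yg).
rewrite !inE => eh yh; apply: (connect_trans eh); apply: connect1.
rewrite /meet_rel gH (connect_eset eH eh) /=.
by apply/set0Pn; exists y; rewrite inE yh.
Qed.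

(** The component of [e] has just two edges: the other one is the partner of [e], and any edge
    meeting the pair belongs to that component. *)
Lemma components_two_cycle_paired H : uniform 3 H ->
  (forall C, component H C -> nontrivial C -> two_cycle C) -> paired (eset H).
Proof.
move=> u tc e eH.
have eC : e \in eset (edge_component H e) by rewrite inE.
have nC : nontrivial (edge_component H e) by apply/set0Pn; exists e.
have [v [c [[_ iv ic _ vc] EC VC]]] := tc _ (edge_component_component u eH) nC.
have cC i : c i \in eset (edge_component H e) by rewrite EC imset_f.
have cH i : c i \in eset H by move: (cC i); rewrite inE => /(connect_eset eH).
move: (eC); rewrite EC => /imsetP[i _ ei].
have nSi : ordS i != i by apply: ordS_neq.
have cases j : j = i \/ j = ordS i.
  by move: i j {ei nSi} => [[|[|//]] Hi] [[|[|//]] Hj];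
    [left|right|right|left]; apply: val_inj.
exists (c (ordS i)); split=> //; first by rewrite ei (inj_eq ic).
  (* Since [ordS] is an involution on ['I_2], both cycle vertices lie on both edges. *)
  apply/card_gt1P; exists (v i), (v (ordS i)).
  have SSi : ordS (ordS i) = i.
    by case: (cases (ordS (ordS i))) => // /eqP; rewrite (inj_eq (@ordS_inj _)) (negPf nSi).
  have := vc (ordS i); have := vc i; rewrite SSi !subUset !sub1set -ei.
  move=> /andP[a b] /andP[d f]; rewrite !inE a b d f.
  by rewrite (inj_eq iv) eq_sym.
move=> g gH gm; have : g \in eset (edge_component H e).
  have /set0Pn[x] := gm; rewrite !inE => /andP[xg xef].
  have {xef} [h hC xh] : exists2 h, h \in eset (edge_component H e) & x \in h.
    by case/orP: xef; [exists e | exists (c (ordS i))].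
  move: hC; rewrite inE => hC.
  apply: (connect_trans hC); apply: connect1; rewrite /meet_rel gH (connect_eset eH hC).
  by apply/set0Pn; exists x; rewrite inE xh.
rewrite EC => /imsetP[j _ ->].
by case: (cases j) => ->; [left; rewrite ei | right].
Qed.

(** * Components of a paired hypergraph *)

(** A chain starting inside an isolated pair cannot leave it: each next edge meets the pair, hence
    belongs to it. *)
Lemma paired_path_last E e f g p : paired E -> isolated_pair E e f ->
  all [in E] (g :: p) -> path (fun f g : {set T} => f :&: g != set0) g p ->
  g \subset e :|: f -> last g p \subset e :|: f.
Proof.
move=> P iso; elim: p g => //= h p IH g /and3P[gE hE pE] /andP[gh pp] gs.
apply: (IH h) => //; first by rewrite /= hE.
have hef : h :&: (e :|: f) != set0.
  have /set0Pn[x] := gh; rewrite inE => /andP[xg xh].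
  by apply/set0Pn; exists x; rewrite inE xh (subsetP gs).
by have [->|->] := iso h hE hef; rewrite ?subsetUl ?subsetUr.
Qed.

Lemma pair_sub e f : forall g, g \in [set e; f] -> g \subset e :|: f.
Proof. by move=> g; rewrite !inE => /orP[] /eqP->; rewrite ?subsetUl ?subsetUr. Qed.

Lemma pair_connected e f : e :&: f != set0 -> connected (Hypergraph (@pair_sub e f)).
Proof.
move=> /set0Pn[a aef]; move: (aef); rewrite inE => /andP[ae af]; split.
  by apply/set0Pn; exists a; rewrite inE ae.
have ef : e :&: f != set0 by apply/set0Pn; exists a.
move=> x y /=; rewrite !inE => /orP[xe|xf] /orP[ye|yf]; right.
- by exists e, [::]; split=> //=; rewrite !inE eqxx.
- by exists e, [:: f]; split=> //=; rewrite ?ef ?inE ?eqxx ?orbT.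
- by exists f, [:: e]; split=> //=; rewrite 1?setIC ?ef ?inE ?eqxx ?orbT.
- by exists f, [::]; split=> //=; rewrite !inE eqxx orbT.
Qed.

Lemma paired_components_two_cycle H : uniform 3 H -> paired (eset H) ->
  forall C, component H C -> nontrivial C -> two_cycle C.
Proof.
move=> u P C [[CH1 CH2] [_ cC] maxC] /set0Pn[e eC].
have eH := subsetP CH2 e eC; have [f [fH fe cef iso]] := P e eH.
have ef : e :&: f != set0 by rewrite -card_gt0 ltnW.
have /set0Pn[x] := uniform_meet_self u eH; rewrite setIid => xe.
have touch g y : g \in eset H -> y \in g -> y \in e :|: f -> g = e \/ g = f.
  by move=> gH yg yef; apply: iso => //; apply/set0Pn; exists y; rewrite inE yg.
have vC : vset C \subset e :|: f.
  apply/subsetP=> y yC.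
  have [<-|[g [p [gp pp xg yl]]]] := cC x y (subsetP (eset_sub eC) x xe) yC.
    by rewrite inE xe.
  have gpH : all [in eset H] (g :: p).
    by apply: sub_all gp => h; apply: (subsetP CH2).
  have gH : g \in eset H by case/andP: gpH.
  have gef : g \subset e :|: f.
    have xef : x \in e :|: f by rewrite inE xe.
    by have [->|->] := touch g x gH xg xef; rewrite ?subsetUl ?subsetUr.
  exact: (subsetP (paired_path_last P iso gpH pp gef) y yl).
have CD : subhypergraph C (Hypergraph (@pair_sub e f)).
  split=> //; apply/subsetP=> g gC; have gH := subsetP CH2 g gC.
  have /set0Pn[y] := uniform_meet_self u gH; rewrite setIid => yg.
  have yef := subsetP vC y (subsetP (eset_sub gC) y yg).
  by have [->|->] := touch g y gH yg yef; rewrite !inE eqxx ?orbT.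
have DH : subhypergraph (Hypergraph (@pair_sub e f)) H.
  split; first by rewrite subUset !eset_sub.
  by rewrite subUset !sub1set eH fH.
(* The pair is connected and contains [C], so maximality of [C] makes them equal. *)
have [/= DC1 DC2] := maxC _ DH (pair_connected ef) CD.
have VC : vset C = e :|: f by apply/eqP; rewrite eqEsubset vC.
have EC : eset C = [set e; f].
  by apply/eqP; rewrite eqEsubset DC2 (CD.2).
have /card_gt1P[a [b [aef bef ab]]] := cef.
have [/setIP[ae _] /setIP[be _]] := (aef, bef).
exists (two a b), (two e f); split.
- split=> //.
  + exact: two_inj.
  + by apply: two_inj; rewrite eq_sym.
  + by move=> i; rewrite VC EC /two; case: ifP => _; rewrite !inE ?ae ?be eqxx ?orbT.
  + exact: two_sub.
- rewrite EC; apply/setP=> g; rewrite !inE; apply/orP/imsetP.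
    by case=> /eqP->; [exists ord0 | exists (lift ord0 ord0)].
  by case=> i _ ->; rewrite /two; case: ifP => _; [left | right].
- by rewrite VC big_ord_recl big_ord1.
Qed.

End Hypergraphs.

Theorem theorem2p2 (T : finType) (H : hypergraph T) (H3 : uniform 3 H) :
  ((tau_c H)%:R <= #|eset H|%:R / 2%:R :> rat)%R /\
  (((tau_c H)%:R = #|eset H|%:R / 2%:R :> rat)%R <->
   (forall C : hypergraph T, component H C -> nontrivial C -> two_cycle C)).
Proof.
have le_half : ((tau_c H)%:R <= #|eset H|%:R / 2%:R :> rat)%R.
  by rewrite Num.Theory.ler_pdivlMr // -GRing.natrM Num.Theory.ler_nat
    mulnC double_tau_c_le.
have eq_half : ((tau_c H)%:R = #|eset H|%:R / 2%:R :> rat)%R <->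
    2 * tau_c H = #|eset H|.
  rewrite mulnC; split=> [/eqP|h]; last apply/eqP.
    by rewrite -(can2_eq (GRing.mulfK _) (GRing.mulfVK _)) // -GRing.natrM
      Num.Theory.eqr_nat => /eqP.
  by rewrite -(can2_eq (GRing.mulfK _) (GRing.mulfVK _)) // -GRing.natrM h.
split=> //; rewrite eq_half (double_tau_c_eq H3); split.
  exact: paired_components_two_cycle.
exact: components_two_cycle_paired.
Qed.
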